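(* Let $n\equiv 3\pmod 4$ with $n>3$. Let $1\le r\le m$, let $M_r\in\mathfrak{C}_r$, and suppose $\det\tilde M_r>0$. Let $E_m^*\in\mathfrak{E}_m$ satisfy $\det E_m^*=\max\{\det E: E\in\mathfrak{E}_m\}$, and write $$E_m^*=\begin{bmatrix}M_r & B\\ B^T & A\end{bmatrix}$$ with $A=(a_{ij})$ of order $m-r$. Then for all $i\neq j$, $a_{ij}\in\{-1,3\}$.
   Context: Fix an integer $n\equiv 3\pmod 4$, $n>3$. For $m\ge1$, $\mathfrak{C}_m$ is the set of symmetric positive definite $m\times m$ integer matrices $C=(c_{ij})$ with $c_{ii}=n$ and $c_{ij}\equiv n\pmod 4$ for all $i,j$. Given a fixed $M_r\in\mathfrak{C}_r$, for $m\ge r$, $\mathfrak{E}_m$ is the set of $E_m\in\mathfrak{C}_m$ whose leading $r\times r$ submatrix is $M_r$. For a square matrix $C$ of order $m$, $\tilde C$ denotes the matrix obtained from $C$ by replacing its $(m,m)$ entry by $3$. *)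

(* Defs.v *)
From HB Require Import structures.
From mathcomp Require Import all_boot all_order all_algebra.
From mathcomp Require Import reals.
Set Implicit Arguments. Unset Strict Implicit. Unset Printing Implicit Defensive.
Import Order.TTheory GRing.Theory Num.Theory.
Local Open Scope ring_scope.

Definition posdef (R : realType) (m : nat) (C : 'M[int]_m) : Prop :=
  forall x : 'cV[R]_m, x != 0 ->
    0 < ((x^T *m map_mx (fun z : int => z%:~R) C *m x) 0 0).

Definition frakC (R : realType) (n m : nat) (C : 'M[int]_m) : Prop :=
  [/\ C^T = C, posdef R C,
      (forall i, C i i = n%:Z) &
      (forall i j, (C i j = n%:Z %[mod 4])%Z)].

Definition frakE (R : realType) (n r m : nat) (M : 'M[int]_r) (E : 'M[int]_m)
  : Prop :=
  frakC R n E /\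
  forall (i j : 'I_r) (i' j' : 'I_m),
    val i' = val i -> val j' = val j -> E i' j' = M i j.

Definition tildemx (m : nat) (C : 'M[int]_m) : 'M[int]_m :=
  \matrix_(i, j) if (val i == m.-1) && (val j == m.-1) then 3 else C i j.

(* Main.v *)
(* Put N = n - 3, let E be a maximal extension and, for a set S of indices
   containing the first r, let h(S) be N ^ (m - #|S|) times the principal minor
   of E on S.  If h(S \ k) < h(S) for some k in S, then filling the missing
   indices with copies of row k (entries 3 between copies) gives an admissible
   matrix of determinant h(S) + #|~: S| (h(S) - h(S \ k)), so
     h(S) + #|~: S| (h(S) - h(S \ k)) <= det E.                            (1)
   The hypothesis on M says that h([r] \ r) < h([r]).  Hence h(S) < det E for all
   proper S: otherwise (1) forces h(S \ k) >= h(S) >= det E for all k in S, and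
   removing indices one at a time down to [r] contradicts the hypothesis.

   For p, q not in [r], write E as the bordering of D = E \ {p, q} by columns
   x, y and the entry a at (p, q); with alpha = n - x' D^-1 x,
   beta = n - y' D^-1 y and g = x' D^-1 y, det E / det D is
   alpha beta - (a - g) ^ 2.  As h(D) < det E, one of alpha, beta exceeds N, say
   alpha; then (1) with S = ~{q}, k = p and Cauchy-Schwarz
   g ^ 2 <= (n - alpha) (n - beta) give |g| < 3.  If a >= 7 (a <= -5), replacing
   a by 3 (by -1) increases the determinant. *)

Require Import Defs.
From HB Require Import structures.
From mathcomp Require Import all_boot all_order all_algebra.
From mathcomp Require Import reals.
From mathcomp Require Import ring lra zify.
Set Implicit Arguments. Unset Strict Implicit. Unset Printing Implicit Defensive.
Import Order.TTheory GRing.Theory Num.Theory.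
Local Open Scope ring_scope.

(** * Determinants of bordered matrices *)

Lemma det_mx2 (R : comNzRingType) (A : 'M[R]_2) :
  \det A = A 0 0 * A 1 1 - A 0 1 * A 1 0.
Proof.
rewrite (expand_det_row _ 0) !big_ord_recl big_ord0 /cofactor !det_mx11 !mxE /=.
have -> : lift ord0 ord0 = 1 :> 'I_2 by apply: val_inj.
have -> : lift 1 ord0 = 0 :> 'I_2 by apply: val_inj.
by rewrite /= expr0 expr1 mul1r mulN1r mulrN addr0.
Qed.

(** Sylvester's identity: the block matrix with unit diagonal blocks and off-diagonal blocks [A] and
    [- B] factors into block triangular matrices in two ways. *)
Lemma det_1_mulmx (R : comNzRingType) m t (A : 'M[R]_(m, t)) (B : 'M[R]_(t, m)) :
  \det (1%:M + A *m B) = \det (1%:M + B *m A).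
Proof.
transitivity (\det (block_mx 1%:M A (- B) 1%:M)).
- have -> : block_mx 1%:M A (- B) 1%:M =
      block_mx 1%:M A 0 1%:M *m block_mx (1%:M + A *m B) 0 (- B) 1%:M.
    rewrite mulmx_block !mul1mx !mul0mx !mulmx1 !add0r mulmxN.
    by rewrite addrK.
  by rewrite det_mulmx det_ublock det_lblock !det1 !(mul1r, mulr1).
have -> : block_mx 1%:M A (- B) 1%:M =
    block_mx 1%:M 0 (- B) 1%:M *m block_mx 1%:M A 0 (1%:M + B *m A).
  rewrite mulmx_block !mul1mx !mul0mx !mulmx1 !addr0 mulNmx.
  by rewrite addrCA addNr addr0.
by rewrite det_mulmx det_ublock det_lblock !det1 !(mul1r, mulr1).
Qed.

(* Schur complement: [T = 1 + P X^T D^-1] is unimodular and clears the borders. *)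
Lemma det_border (F : fieldType) m t (c : F) (D : 'M_m) (P X : 'M_(m, t)) (K : 'M_t) :
  c != 0 -> D^T = D -> D \in unitmx -> D *m P = c *: P -> P^T *m P = 1%:M ->
  P^T *m X = 0 ->
  \det (D + P *m X^T + X *m P^T + P *m K *m P^T) =
  \det D * \det (1%:M + c^-1 *: (K - X^T *m invmx D *m X)).
Proof.
move=> c0 Ds Du DP PP PX.
set G := invmx D; set L := K - _.
have GP : G *m P = c^-1 *: P.
  by apply: (can_inj (mulKmx Du)); rewrite mulKVmx // -scalemxAr DP scalerK.
have Gs : G^T = G by rewrite trmx_inv Ds.
have XP : X^T *m P = 0 by rewrite -(trmxK P) -trmx_mul PX trmx0.
set T := 1%:M + P *m (X^T *m G).
have TP : T *m P = P.
  by rewrite mulmxDl mul1mx -!mulmxA GP -scalemxAr XP scaler0 mulmx0 addr0.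
have detT : \det T = 1.
  by rewrite det_1_mulmx -mulmxA GP -scalemxAr XP scaler0 addr0 det1.
have -> : D + P *m X^T + X *m P^T + P *m K *m P^T =
    T *m (D + P *m L *m P^T) *m T^T.
  rewrite mulmxDr mulmxDl.
  have -> : T *m (P *m L *m P^T) *m T^T = P *m L *m P^T.
    by rewrite !mulmxA TP -mulmxA -trmx_mul TP.
  rewrite mulmxDl mul1mx -!mulmxA mulVmx // mulmx1.
  rewrite linearD /= trmx1 mulmxDr mulmx1 !trmx_mul Gs trmxK.
  rewrite !mulmxDl !mulmxA mulmxV // mul1mx -!addrA; congr (_ + (_ + (_ + _))).
  by rewrite mulmxDr mulNmx mulmxN !mulmxA addrC subrK.
rewrite !det_mulmx det_tr detT mul1r mulr1.
have -> : D + P *m L *m P^T = D *m (1%:M + P *m (c^-1 *: L *m P^T)).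
  rewrite mulmxDr mulmx1 [D *m (P *m _)]mulmxA DP -!scalemxAl -!scalemxAr.
  by rewrite scalerA divff // scale1r mulmxA.
by rewrite det_mulmx det_1_mulmx -mulmxA PP mulmx1.
Qed.

(* [\det (mask c S A)] is [c ^ #|~: S|] times the principal minor of [A] on [S];
   all minors are thus handled as m x m determinants. *)
Definition mask (T : pzRingType) m (c : T) (S : {set 'I_m}) (A : 'M[T]_m) : 'M_m :=
  \matrix_(i, j) if (i \in S) && (j \in S) then A i j else c *+ (i == j).

(* Rows and columns [p] and [q] of [D] are overwritten by [x] and [y], the 2 x 2
   block at [p, q] by [[a, b], [b, c]]. *)
Definition bord (T : Type) m (p q : 'I_m) (D : 'M[T]_m) (x y : 'I_m -> T) (a b c : T)
  : 'M_m :=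
  \matrix_(i, j)
    if i == p then if j == p then a else if j == q then b else x j else
    if i == q then if j == p then b else if j == q then c else y j else
    if j == p then x i else if j == q then y i else D i j.

(* The form x^T D^-1 y, where the indices [p] and [q] are deleted from x, y and D. *)
Definition gram (F : fieldType) m (d : F) (p q : 'I_m) (D : 'M[F]_m) (x y : 'I_m -> F) : F :=
  ((\col_i (x i *+ (i \notin [set p; q])))^T *m invmx (mask d (~: [set p; q]) D)
    *m (\col_i (y i *+ (i \notin [set p; q])))) 0 0.

(** The case [t = 2] of [det_border]: the columns of [P] are the unit vectors at [p] and [q]. The
    factor [d ^+ 2] makes up for the two entries [d] that the mask puts at the deleted indices. *)
Lemma det_bord (F : fieldType) m (d : F) (p q : 'I_m) (D : 'M_m) x y a b c :
  d != 0 -> p != q -> D^T = D -> mask d (~: [set p; q]) D \in unitmx ->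
  \det (bord p q D x y a b c) * d ^+ 2 =
  \det (mask d (~: [set p; q]) D) *
  ((a - gram d p q D x x) * (c - gram d p q D y y) - (b - gram d p q D x y) ^+ 2).
Proof.
move=> d0 pq Ds; rewrite /gram; set D0 := mask _ _ _ => D0u.
set vx := \col_i (x i *+ _); set vy := \col_i (y i *+ _).
pose P : 'M[F]_(m, 2) := \matrix_(i, j) (i == if j == 0 then p else q)%:R.
pose X : 'M[F]_(m, 2) := \matrix_(i, j) if j == 0 then vx i 0 else vy i 0.
(* The mask already carries [d] at the diagonal positions [p] and [q], hence the shift by [d]. *)
pose K : 'M[F]_2 := \matrix_(i, j)
  if i == 0 then if j == 0 then a - d else b else if j == 0 then b else c - d.
have qp : (q == p) = false by rewrite eq_sym (negPf pq).
have D0s : D0^T = D0.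
  apply/matrixP=> i j; rewrite !mxE andbC eq_sym; case: ifP => // _.
  by rewrite -[in LHS]Ds mxE.
have DP : D0 *m P = d *: P.
  apply/matrixP=> i j; rewrite !mxE; set k := if _ then _ else _.
  rewrite (bigD1 k) //= big1 => [|l lk]; last by rewrite !mxE (negPf lk) mulr0.
  have kS : (k \in ~: [set p; q]) = false.
    by rewrite !inE /k; case: ifP; rewrite eqxx ?orbT.
  by rewrite !mxE eqxx mulr1 addr0 kS andbF mulr_natr.
have PP : P^T *m P = 1%:M.
  apply/matrixP=> i j; rewrite !mxE; set k := if i == 0 then p else q.
  rewrite (bigD1 (if i == 0 then p else q)) //= big1 => [|l lk]; last first.
    by rewrite !mxE (negPf lk) mul0r.
  rewrite !mxE eqxx mul1r addr0; congr (_%:R).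
  case: i @k => [[|[|//]] ?] k; case: j => [[|[|//]] ?] /=;
  by rewrite ?eqxx ?(negPf pq) ?qp.
have PX : P^T *m X = 0.
  apply/matrixP=> i j; rewrite !mxE big1 // => k _; rewrite !mxE.
  case: eqP => [->|_]; last by rewrite mul0r.
  by case: ifP => _; case: ifP => _; rewrite !inE eqxx ?orbT mulr0.
have := det_border K d0 D0s D0u DP PP PX.
have -> : D0 + P *m X^T + X *m P^T + P *m K *m P^T = bord p q D x y a b c.
  apply/matrixP=> i j; rewrite !mxE !big_ord_recl !big_ord0 !mxE.
  rewrite !big_ord_recl !big_ord0 !mxE /= !inE.
  case: (i =P p) => [->|/eqP ip]; case: (j =P p) => [->|/eqP jp];
  rewrite ?eqxx ?(negPf pq) ?qp ?(negPf ip) ?(negPf jp) /=.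
  - by ring.
  - by case: (j =P q) => [->|/eqP jq]; rewrite ?eqxx ?(negPf pq) ?qp 
      ?[p == j]eq_sym ?(negPf jp) ?[q == j]eq_sym ?(negPf jq) /=; ring.
  - by case: (i =P q) => [->|/eqP iq]; rewrite ?eqxx ?(negPf pq) ?qp 
      ?(negPf iq) /=; ring.
  case: (i =P q) => [->|/eqP iq]; case: (j =P q) => [->|/eqP jq];
  rewrite ?eqxx ?(negPf pq) ?qp ?(negPf iq) ?(negPf jq) /= ?[q == j]eq_sym ?(negPf jq) /=;
  by ring.
move=> ->; rewrite -mulrA; congr (_ * _).
have E u v : (X^T *m invmx D0 *m X) u v =
   ((if u == 0 then vx else vy)^T *m invmx D0 *m (if v == 0 then vx else vy)) 0 0.
  rewrite !mxE; apply: eq_bigr => k _; rewrite !mxE.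
  case: (v == 0); rewrite ?mxE; congr (_ * _).
    by apply: eq_bigr => l _; rewrite !mxE; case: (u == 0); rewrite ?mxE.
  by apply: eq_bigr => l _; rewrite !mxE; case: (u == 0); rewrite ?mxE.
have gs : (vy^T *m invmx D0 *m vx) 0 0 = (vx^T *m invmx D0 *m vy) 0 0.
  by rewrite -[LHS]trace_mx11 -[RHS]trace_mx11 -mxtrace_tr !trmx_mul trmxK trmx_inv D0s mulmxA.
move: (X^T *m invmx D0 *m X) E => Y E.
have ME u v : (1%:M + d^-1 *: (K - Y)) u v = (u == v)%:R + d^-1 * (K u v - Y u v).
  by rewrite !mxE.
have K00 : K 0 0 = a - d by rewrite mxE.
have K01 : K 0 1 = b by rewrite mxE.
have K10 : K 1 0 = b by rewrite mxE.
have K11 : K 1 1 = c - d by rewrite mxE.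
by rewrite det_mx2 !ME !E K00 K01 K10 K11 /= gs; field.
Qed.

(** * Positive definite real matrices *)

Definition pd (R : realType) m (A : 'M[R]_m) : Prop :=
  forall x : 'cV[R]_m, x != 0 -> 0 < (x^T *m A *m x) 0 0.

Lemma sqr_cV_gt0 (R : realType) m (x : 'cV[R]_m) : x != 0 -> 0 < (x^T *m x) 0 0.
Proof.
move=> x0; rewrite mxE.
have ge0 i : 0 <= x^T 0 i * x i 0 by rewrite mxE -expr2 sqr_ge0.
rewrite lt_def sumr_ge0 // andbT; apply: contra_neq x0 => /psumr_eq0P s0.
apply/matrixP=> i j; rewrite ord1 mxE; have /eqP := s0 (fun i _ => ge0 i) i isT.
by rewrite mxE mulf_eq0 orbb => /eqP.
Qed.

Lemma pd_det_gt0 (R : realType) m (A : 'M[R]_m) : pd A -> 0 < \det A.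
Proof.
(* Otherwise [\det (t A + (1 - t) I)] vanishes for some t in [0, 1]. *)
move=> pA; rewrite ltNge; apply/negP => dA.
pose Mp := \matrix_(i, j) ((A i j - (i == j)%:R)%:P * 'X + (i == j)%:R%:P).
have pE t : (\det Mp).[t] = \det (t *: A + (1 - t) *: 1%:M).
  rewrite -/(horner_eval t _) -det_map_mx; congr (\det _).
  by apply/matrixP=> i j; rewrite !mxE /= /horner_eval !hornerE; ring.
have [||t /andP[t0 t1]] := @poly_ivt R (- \det Mp) 0 1; first exact: ler01.
  rewrite !hornerN !pE scale0r add0r subr0 scale1r det1 lerN10 /=.
  by rewrite scale1r subrr scale0r addr0 oppr_ge0.
rewrite rootN /root pE => /det0P[v v0] vM.
have : (v *m (t *: A + (1 - t) *: 1%:M) *m v^T) 0 0 = 0 by rewrite vM mul0mx mxE.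
apply/eqP; rewrite gt_eqF // mulmxDr mulmxDl -!scalemxAr -!scalemxAl mulmx1.
have w0 : v^T != 0 by rewrite -trmx0 (can_eq (@trmxK _ _ _)).
have := sqr_cV_gt0 w0; have := pA _ w0; rewrite trmxK.
rewrite [X in _ -> _ -> _ < X]mxE [X in _ -> _ -> _ < X + _]mxE.
rewrite [X in _ -> _ -> _ < _ + X]mxE; nra.
Qed.

(** Split [x] into its part [y] supported on [S] and its part [z] off [S]: the form becomes y' A y +
    c z' z. *)
Lemma pd_mask (R : realType) m c (S : {set 'I_m}) (A : 'M[R]_m) :
  0 < c -> pd A -> pd (mask c S A).
Proof.
move=> c0 pA x x0.
pose y := \col_i (x i 0 *+ (i \in S)); pose z := \col_i (x i 0 *+ (i \notin S)).
have -> : x^T *m mask c S A *m x = y^T *m A *m y + c *: (z^T *m z).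
  have -> : c *: (z^T *m z) = z^T *m (c%:M) *m z by rewrite mul_mx_scalar -scalemxAl.
  apply/matrixP=> i j; rewrite !mxE -big_split; apply: eq_bigr => k _ /=.
  rewrite !mxE !mulr_suml -big_split; apply: eq_bigr => l _ /=; rewrite !mxE !ord1.
  case: (l =P k) => [->|_]; case: (k \in S); rewrite ?andbF ?andbT;
  try case: (l \in S); rewrite /= ?mulr1n ?mulr0n; ring.
rewrite mxE [X in _ + X]mxE.
have xE : x = y + z.
  apply/matrixP=> i j; rewrite !mxE ord1; case: (i \in S); rewrite /= ?mulr1n ?mulr0n; ring.
have [y0|y0] := eqVneq y 0; last first.
  rewrite ltr_wpDr ?pA // mulr_ge0 ?(ltW c0) //.
  have [->|/sqr_cV_gt0/ltW//] := eqVneq z 0.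
  by rewrite mulmx0 mxE lexx.
rewrite y0 mulmx0 mxE add0r mulr_gt0 // sqr_cV_gt0 //.
by apply: contra_neq x0 => z0; rewrite xE y0 z0 addr0.
Qed.

(** The inductive step of Sylvester's criterion. Let w = A^-1 e_p. Every [x] is y + t w with y_p =
    0, and y' A w = y_p = 0, so the form at [x] is the masked form at [y] plus t^2 w_p. Here w_p is
    the principal minor without [p] divided by det A, hence positive. *)
Lemma pd_of_det_gt0 (R : realType) m c (p : 'I_m) (A : 'M[R]_m) :
  0 < c -> A^T = A -> pd (mask c (~: [set p]) A) -> 0 < \det A -> pd A.
Proof.
move=> c0 As pM dA.
have Au : A \in unitmx by rewrite unitmxE unitfE gt_eqF.
pose e : 'cV[R]_m := delta_mx p 0; pose w := invmx A *m e.
have Aw : A *m w = e by rewrite mulKVmx.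
have wp : 0 < w p 0.
  have -> : w p 0 = (\det A)^-1 * cofactor A p p.
    rewrite /w /e -colE mxE /invmx Au !mxE //.
  rewrite mulr_gt0 ?invr_gt0 //.
  have := pd_det_gt0 pM; rewrite (expand_det_row _ p) (bigD1 p) //= big1 => [|j jp].
    rewrite addr0 mxE !inE eqxx pmulr_rgt0 //; congr (_ < _).
    rewrite /cofactor; congr (_ * \det _).
    by apply/matrixP=> i j; rewrite !mxE !inE ![lift _ _ == p]eq_sym !neq_lift.
  by rewrite mxE !inE eqxx /= eq_sym (negPf jp) mul0r.
move=> x x0.
have [y [t [yp xE]]] : exists (y : 'cV[R]_m) t, y p 0 = 0 /\ x = y + t *: w.
  exists (x - (x p 0 / w p 0) *: w), (x p 0 / w p 0); split; last by rewrite subrK.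
  by rewrite 3!mxE divfK ?subrr // gt_eqF.
rewrite {1 2}xE.
have -> : (y + t *: w)^T *m A *m (y + t *: w) =
    y^T *m mask c (~: [set p]) A *m y + (t ^+ 2 * w p 0)%:M.
  have yA : y^T *m mask c (~: [set p]) A *m y = y^T *m A *m y.
    apply/matrixP=> i j; rewrite !mxE; apply: eq_bigr => k _ /=.
    rewrite !mxE !mulr_suml; apply: eq_bigr => l _ /=; rewrite ![_^T _ _]mxE !ord1.
    rewrite [mask _ _ _ _ _]mxE !inE.
    by case: (l =P p) => [->|_]; case: (k =P p) => [->|_] /=; rewrite ?yp ?(mul0r, mulr0).
  have ye : y^T *m e = 0.
    by rewrite /e -colE; apply/matrixP=> i j; rewrite !mxE ord1.
  have ey : e^T *m y = 0 by rewrite -(trmxK y) -trmx_mul ye trmx0.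
  have we : w^T *m e = (w p 0)%:M.
    by rewrite /e -colE; apply/matrixP=> i j; rewrite !mxE !ord1.
  have wA : w^T *m A = e^T by have := congr1 trmx Aw; rewrite trmx_mul As.
  have -> : (y + t *: w)^T = y^T + t *: w^T by rewrite linearD linearZ.
  rewrite !mulmxDl !mulmxDr -!scalemxAl -!scalemxAr.
  rewrite -!mulmxA Aw !mulmxA wA ey ye !scaler0 addr0 add0r yA.
  by rewrite we scalerA -expr2 scale_scalar_mx.
rewrite mxE [X in _ + X]mxE eqxx mulr1n.
have [y0|y0] := eqVneq y 0; last first.
  by rewrite ltr_wpDr ?pM // mulr_ge0 ?sqr_ge0 ?(ltW wp).
rewrite y0 mulmx0 mxE add0r mulr_gt0 // exprn_even_gt0 //=.
by apply: contra_neq x0 => t0; rewrite xE y0 t0 scale0r addr0.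
Qed.

(** The inverse of the masked matrix is again positive definite: u' D^-1 u = v' D v for v = D^-1
    u. *)
Lemma gram_cauchy_schwarz (R : realType) m (d : R) p q (D : 'M[R]_m) x y :
  D^T = D -> pd (mask d (~: [set p; q]) D) ->
  [/\ 0 <= gram d p q D x x, 0 <= gram d p q D y y &
      gram d p q D x y ^+ 2 <= gram d p q D x x * gram d p q D y y].
Proof.
move=> Ds; rewrite /gram; set D0 := mask _ _ _ => pD.
have D0s : D0^T = D0.
  apply/matrixP=> i j; rewrite !mxE andbC eq_sym; case: ifP => // _.
  by rewrite -[in LHS]Ds mxE.
have D0u : D0 \in unitmx by rewrite unitmxE unitfE gt_eqF // pd_det_gt0.
pose f (u v : 'cV[R]_m) := (u^T *m invmx D0 *m v) 0 0.
have fp u : u != 0 -> 0 < f u u.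
  move=> u0; have v0 : invmx D0 *m u != 0.
    by apply: contra_neq u0 => /(congr1 (mulmx D0)); rewrite mulKVmx // mulmx0.
  by have := pD _ v0; rewrite trmx_mul trmx_inv D0s -!mulmxA mulKVmx // mulmxA.
have f0 u : f 0 u = 0 by rewrite /f trmx0 !mul0mx mxE.
have f0' u : f u 0 = 0 by rewrite /f mulmx0 mxE.
have fge u : 0 <= f u u by have [->|/fp/ltW//] := eqVneq u 0; rewrite f0 lexx.
have fC u v : f u v = f v u.
  rewrite /f -[LHS]trace_mx11 -[RHS]trace_mx11 -mxtrace_tr.
  by rewrite !trmx_mul trmxK trmx_inv D0s mulmxA.
set u := \col_i (x i *+ _); set v := \col_i (y i *+ _).
rewrite -/(f u u) -/(f v v) -/(f u v); split=> //.
have [v0|v0] := eqVneq v 0; first by rewrite v0 !f0' mulr0 expr0n.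
have fB a b : f (a *: u - b *: v) (a *: u - b *: v) =
    a ^+ 2 * f u u - 2 * a * b * f u v + b ^+ 2 * f v v.
  transitivity (a * a * f u u - a * b * f u v - b * a * f v u + b * b * f v v).
    rewrite /f (_ : (_ - _)^T = a *: u^T - b *: v^T); last by rewrite linearB !linearZ.
    rewrite !mulmxBl !mulmxBr -!scalemxAl -!scalemxAr.
    rewrite !scalerA; move: (u^T *m _ *m u) (v^T *m _ *m u) (u^T *m _ *m v) => X Y Z.
    by move: (v^T *m _ *m v) => W; rewrite !mxE; ring.
  by rewrite (fC v u); ring.
(* The form at this vector is [f v v] times the Cauchy-Schwarz defect, and [f v v] is positive. *)
have := fge (f v v *: u - f u v *: v); rewrite fB.
have -> : f v v ^+ 2 * f u u - 2 * f v v * f u v * f u v + f u v ^+ 2 * f v v =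
  f v v * (f u u * f v v - f u v ^+ 2) by ring.
by rewrite pmulr_rge0 ?fp // subr_ge0.
Qed.

Lemma gram0r (F : fieldType) m (d : F) p q (D : 'M[F]_m) x :
  gram d p q D x (fun=> 0) = 0.
Proof.
rewrite /gram; set v := (X in _ *m X).
have -> : v = 0 by apply/matrixP=> i j; rewrite !mxE mul0rn.
by rewrite mulmx0 mxE.
Qed.

(** * Transfer to integer matrices *)

Lemma map_mask (R : pzRingType) m (c : int) S (A : 'M[int]_m) :
  map_mx (fun z : int => z%:~R : R) (mask c S A) =
  mask c%:~R S (map_mx (fun z : int => z%:~R) A).
Proof.
by apply/matrixP=> i j; rewrite !mxE; case: ifP => // _; case: eqP.
Qed.

Lemma det_map_intr (R : comNzRingType) m (A : 'M[int]_m) :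
  \det (map_mx (fun z : int => z%:~R : R) A) = (\det A)%:~R.
Proof. by rewrite -(det_map_mx (intr : {rmorphism int -> R})). Qed.

Lemma mask_mask (T : pzRingType) m (c : T) (S S' : {set 'I_m}) A :
  mask c S (mask c S' A) = mask c (S :&: S') A.
Proof.
apply/matrixP=> i j; rewrite !mxE !inE.
by case: (i \in S); case: (j \in S); case: (i \in S'); case: (j \in S').
Qed.

Lemma mask_setT (T : pzRingType) m (c : T) (A : 'M_m) : mask c setT A = A.
Proof. by apply/matrixP=> i j; rewrite !mxE !inE. Qed.

Lemma posdef_mask (R : realType) m (c : int) S (A : 'M[int]_m) :
  0 < c -> posdef R A -> posdef R (mask c S A).
Proof.
move=> c0 pA; rewrite /posdef map_mask; apply: pd_mask => //.
by rewrite ltr0z.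
Qed.

Lemma posdef_det_gt0 (R : realType) m (A : 'M[int]_m) : posdef R A -> 0 < \det A.
Proof. by move=> /pd_det_gt0; rewrite det_map_intr ltr0z. Qed.

Lemma posdef_of_det_gt0 (R : realType) m c (p : 'I_m) (A : 'M[int]_m) :
  0 < c -> A^T = A -> posdef R (mask c (~: [set p]) A) -> 0 < \det A -> posdef R A.
Proof.
move=> c0 As; rewrite /posdef map_mask => pM dA.
apply: (pd_of_det_gt0 _ _ pM); first by rewrite ltr0z.
  by apply/matrixP=> i j; rewrite -[in RHS]As !mxE.
by rewrite det_map_intr ltr0z.
Qed.

(** Schur complements of integer matrices need not be integers, so the Gram form [g] takes values in
    [R]. It depends only on [D], [p], [q] and [c]; a single [g] therefore compares all borderings of
    the same [D]. *)
Lemma det_bord_int (R : realType) m (c : int) (p q : 'I_m) (D : 'M[int]_m) :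
  0 < c -> p != q -> D^T = D -> posdef R (mask c (~: [set p; q]) D) ->
  exists g : ('I_m -> int) -> ('I_m -> int) -> R,
  [/\ forall x y u v w, (\det (bord p q D x y u v w))%:~R * c%:~R ^+ 2 =
        (\det (mask c (~: [set p; q]) D))%:~R *
        ((u%:~R - g x x) * (w%:~R - g y y) - (v%:~R - g x y) ^+ 2),
      forall x, g x (fun=> 0) = 0,
      forall x, 0 <= g x x &
      forall x y, g x y ^+ 2 <= g x x * g y y].
Proof.
move=> c0 pq Ds; rewrite /posdef map_mask => pD.
pose f (x : 'I_m -> int) i : R := (x i)%:~R.
have Ds' : (map_mx (fun z : int => z%:~R : R) D)^T = map_mx (fun z : int => z%:~R) D.
  by apply/matrixP=> i j; rewrite -[in RHS]Ds !mxE.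
exists (fun x y => gram c%:~R p q (map_mx (fun z => z%:~R) D) (f x) (f y)).
split=> [x y u v w|x|x|x y].
- rewrite -!det_map_intr map_mask -det_bord //.
  + congr (\det _ * _); apply/matrixP=> i j; rewrite !mxE; by do !case: ifP => //.
  + by rewrite intr_eq0 gt_eqF.
  by rewrite unitmxE unitfE gt_eqF // pd_det_gt0.
- exact: gram0r.
- by case: (gram_cauchy_schwarz (f x) (f x) Ds' pD).
- by case: (gram_cauchy_schwarz (f x) (f y) Ds' pD).
Qed.

Lemma bord_sym (T : Type) m (p q : 'I_m) (D : 'M[T]_m) x y u v w :
  D^T = D -> (bord p q D x y u v w)^T = bord p q D x y u v w.
Proof.
move=> Ds; apply/matrixP=> i j; rewrite !mxE -[in LHS]Ds mxE.
by case: (i =P p); case: (j =P p); case: (i =P q); case: (j =P q).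
Qed.

(** * Partially filled extensions *)

(** A stage of the filling process: the indices outside [S] still carry the scalar n - 3. For
    [S = setT] the conditions reduce to those of [frakC]. *)
Definition partial_design (R : realType) n m (S : {set 'I_m}) (A : 'M[int]_m) : Prop :=
  [/\ A^T = A, posdef R A, mask (n%:Z - 3) S A = A,
      forall i, i \in S -> A i i = n%:Z &
      forall i j, i \in S -> j \in S -> (A i j = n%:Z %[mod 4])%Z].

Definition extends r m (M : 'M[int]_r) (A : 'M[int]_m) : Prop :=
  forall (i j : 'I_r) (i' j' : 'I_m),
    val i' = val i -> val j' = val j -> A i' j' = M i j.

(** Cut after index [r], the matrix is block triangular with diagonal blocks [M] and [c%:M]. *)
Lemma det_extends r m (c : int) (M : 'M[int]_r) (B : 'M[int]_m) : (r <= m)%N ->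
  extends M B ->
  (forall i j : 'I_m, ~~ ((i < r)%N && (j < r)%N) -> B i j = c *+ (i == j)) ->
  \det B = \det M * c ^+ (m - r).
Proof.
move=> rm; have ms := esym (subnKC rm); move: (m - r)%N ms => s ms.
move: B rm; rewrite {}ms => B _ BM Bout.
rewrite -[B]submxK; have -> : dlsubmx B = 0.
  apply/matrixP=> i j; rewrite !mxE Bout /= ?ltnNge ?leq_addr //.
  rewrite (_ : _ == _ = false) //; apply/eqP => /(congr1 val) /= e.
  by have := ltn_ord j; rewrite -e ltnNge leq_addr.
have -> : ulsubmx B = M by apply/matrixP=> i j; rewrite !mxE; apply: BM.
have -> : drsubmx B = c%:M.
  apply/matrixP=> i j; rewrite !mxE Bout /= ?ltnNge ?leq_addr //.
  by rewrite (inj_eq (@rshift_inj _ _)).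
by rewrite det_ublock det_scalar.
Qed.

(** * Inequalities between Schur complements *)

(** In the application [d], [u], [v], [e] are normalised minors without both, one, the other and
    none of two indices. The bounds on [u] and [v] say that the Schur complements [a] and [b] are at
    most [N], whence a b - s^2 <= N^2. *)
Lemma schur_le (F : realFieldType) (d N a b s e u v : F) :
  0 < d -> 0 < N -> 0 < u -> u <= d -> v <= d ->
  e * N ^+ 2 = d * (a * b - s ^+ 2) -> u * N ^+ 2 = d * (a * N) ->
  v * N ^+ 2 = d * (N * b) -> e <= d.
Proof.
move=> d0 N0 u0 ud vd eE uE vE.
have ua : d * a = u * N by apply: (mulIf (lt0r_neq0 N0)); rewrite -[LHS]mulrA -uE expr2 mulrA.
have vb : d * b = v * N by apply: (mulIf (lt0r_neq0 N0));
  rewrite -[LHS]mulrA [b * N]mulrC -vE expr2 mulrA.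
have a0 : 0 <= a by rewrite -(pmulr_rge0 _ d0) ua mulr_ge0 // ltW.
have aN : a <= N by rewrite -(ler_pM2l d0) ua ler_pM2r.
have bN : b <= N by rewrite -(ler_pM2l d0) vb ler_pM2r.
have abN : a * b <= N * N.
  by rewrite (le_trans (ler_wpM2l a0 bN)) // ler_pM2r.
rewrite -(ler_pM2r (exprn_gt0 2 N0)) eE ler_pM2l // lerBlDr expr2 ler_wpDr ?sqr_ge0 //.
Qed.

(** Put alpha = N + 3 - a and beta = N + 3 - b. From [d < u] comes alpha > N, that is a < 3; if c^2
    >= 9, then a b >= 9 gives b > 3, so beta < N. But [u + (u - d) <= e] reads 2 alpha N - N^2 <=
    alpha beta - s^2 <= alpha N, so alpha <= N, a contradiction. *)
Lemma schur_corr_lt (F : realFieldType) (d N a b c s e u : F) :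
  0 < d -> 0 < N -> 0 <= a -> c ^+ 2 <= a * b ->
  e * N ^+ 2 = d * ((N + 3 - a) * (N + 3 - b) - s ^+ 2) ->
  u * N ^+ 2 = d * ((N + 3 - a) * N) -> d < u -> u + (u - d) <= e -> c ^+ 2 < 9.
Proof.
move=> d0 N0 a0 cab eE uE du ue; rewrite ltNge; apply/negP => c9.
have N20 : 0 < N ^+ 2 by rewrite exprn_gt0.
have a3 : N < N + 3 - a.
  by rewrite -(ltr_pM2r N0) -(ltr_pM2l d0) -uE -expr2 ltr_pM2r.
have b3 : 3 < b.
  by rewrite ltNge; apply/negP => b3; have := ler_wpM2l a0 b3; lra.
have : 2 * ((N + 3 - a) * N) - N ^+ 2 <= (N + 3 - a) * (N + 3 - b) - s ^+ 2.
  rewrite -(ler_pM2l d0) -eE.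
  have -> : d * (2 * ((N + 3 - a) * N) - N ^+ 2) = (u + (u - d)) * N ^+ 2.
    by rewrite !mulrDl uE; ring.
  by rewrite ler_pM2r.
have : (N + 3 - a) * (N + 3 - b) <= (N + 3 - a) * N.
  by rewrite ler_wpM2l; lra.
have : N * N < (N + 3 - a) * N by rewrite ltr_pM2r.
have := sqr_ge0 s; rewrite expr2; lra.
Qed.

(** * Row duplication and minors of a maximal extension *)

Section Maximal.
Variables (R : realType) (n r m : nat) (M : 'M[int]_r) (E : 'M[int]_m).
Hypotheses (n_mod : (n %% 4 = 3)%N) (n_gt3 : (3 < n)%N).
Hypothesis E_max : forall A : 'M[int]_m, frakE R n M A -> \det A <= \det E.

Let N : int := n%:Z - 3.
Let N_gt0 : 0 < N. Proof. by rewrite subr_gt0 ltz_nat. Qed.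

(** Induction on the number of missing indices. Filling one index [p] with a copy of row [k] raises
    the determinant by the difference on the left. Deleting [p] again gives back [A], so the next
    copy, made from [p], has the same increment, and the determinants form an arithmetic
    progression. *)
Lemma det_duplication (S : {set 'I_m}) A k : partial_design R n S A -> extends M A ->
  (forall i : 'I_m, (i < r)%N -> i \in S) -> k \in S ->
  \det (mask N (~: [set k]) A) < \det A ->
  \det A + (\det A - \det (mask N (~: [set k]) A)) *+ #|~: S| <= \det E.
Proof.
have [s] := ubnP #|~: S|; elim: s => // s IH in S A k *; rewrite ltnS => Ss.
move=> [As Ap AS An Am] AM rS kS dA.
have [S0|[p]] := set_0Vmem (~: S).
  rewrite S0 cards0 mulr0n addr0; apply: E_max; split=> //.
  have ST i : i \in S by rewrite -[S]setCK S0 setC0 inE.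
  by split=> // i *; [apply: An | apply: Am].
rewrite inE => pS.
have kp : k != p by apply: contraNneq pS => <-.
have Aout i j : ~~ ((i \in S) && (j \in S)) -> A i j = N *+ (i == j).
  by move=> h; rewrite -[in LHS]AS mxE (negPf h).
have Apj j : A p j = N *+ (p == j) by apply: Aout; rewrite (negPf pS).
have Ajp j : A j p = N *+ (j == p) by apply: Aout; rewrite (negPf pS) andbF.
have Aji i j : A j i = A i j by rewrite -[in LHS]As mxE.
pose A' := bord k p A (A k) (A k) n%:Z 3 n%:Z.
have A's : A'^T = A' by apply: bord_sym.
have A'A : mask N (~: [set p]) A' = A.
  apply/matrixP=> i j; rewrite !mxE !inE.
  case: (i =P p) => [->|_] /=; first by rewrite Apj.
  case: (j =P p) => [->|_] /=; first by rewrite Ajp.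
  by case: (i =P k) => [->|_]; case: (j =P k) => [->|_]; rewrite ?An.
(* Row and column [p] of [A] are still [N] times a unit vector, so masking [p] as well changes
   nothing. *)
have D0E : mask N (~: [set k; p]) A = mask N (~: [set k]) A.
  apply/matrixP=> i j; rewrite !mxE !inE.
  case: (i =P p) => [->|_]; first by rewrite !Apj !if_same.
  case: (j =P p) => [->|_]; first by rewrite !Ajp !if_same.
  by rewrite !orbF.
have AE : A = bord k p A (A k) (fun=> 0) n%:Z 0 N.
  apply/matrixP=> i j; rewrite !mxE.
  case: (i =P k) => [->|/eqP ik]; case: (j =P k) => [->|/eqP jk]; rewrite ?An //.
  - by case: (j =P p) => [->|//]; rewrite Ajp (negPf kp).
  - by case: (i =P p) => [->|//]; rewrite Apj eq_sym (negPf kp).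
  case: (i =P p) => [->|/eqP ip]; first by rewrite Apj [p == j]eq_sym; case: eqP.
  by case: (j =P p) => [->|//]; rewrite Ajp (negPf ip).
have [g [gdet g0 gge gcs]] := det_bord_int N_gt0 kp As (posdef_mask _ N_gt0 Ap).
(* With alpha = N + 3 - g(x, x) for x = [A k], the corner 3 gives 3 - g(x, x) = alpha - N, so the
   Schur determinant of [A'] is alpha^2 - (alpha - N)^2 = 2 alpha N - N^2, against alpha N for
   [A]. *)
have detA' : \det A' = \det A + (\det A - \det (mask N (~: [set k]) A)).
  have := gdet (A k) (A k) n%:Z 3 n%:Z; rewrite -/A' D0E.
  have := gdet (A k) (fun=> 0) n%:Z 0 N; rewrite -AE D0E !g0.
  have NR : N%:~R != 0 :> R by rewrite intr_eq0 gt_eqF.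
  have -> : n%:Z%:~R = N%:~R + 3 :> R by rewrite /N rmorphB /= subrK.
  move=> e1 e2; apply: (@intr_inj R); rewrite !rmorphD rmorphN /=.
  apply: (mulIf (expf_neq0 2 NR)); rewrite e2; move: e1.
  lra.
have A'p : posdef R A'.
  apply: (posdef_of_det_gt0 (p := p) N_gt0) => //; first by rewrite A'A.
  have := posdef_det_gt0 Ap; rewrite detA'; lia.
have A'out i j : i != p -> j != p -> A' i j = A i j.
  move=> ip jp; by rewrite -[in RHS]A'A [mask _ _ _ _ _]mxE !inE ip jp.
have cS : #|~: S| = #|~: (p |: S)|.+1.
  rewrite (cardsD1 p) !inE pS; congr _.+1; apply: eq_card => l.
  by rewrite !inE negb_or.
have A'S : partial_design R n (p |: S) A'.
  split=> // [|i|i j].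
  - apply/matrixP=> i j; rewrite mxE !inE -/N; case: ifP => // ijS.
    have kout l : l \notin S -> (l == k) = false.
      by move=> lS; apply: contraNF lS => /eqP ->.
    have Akout l : l \notin S -> A k l = 0.
      by move=> lS; rewrite Aout ?(negPf lS) ?andbF // eq_sym kout.
    move: ijS; rewrite mxE; case: (i =P p) => [->|/eqP ip] /=.
      rewrite [p == k]eq_sym (negPf kp) ?eqxx /=; case: (j =P p) => //= /eqP jp jS.
      have {}jS : j \notin S by rewrite jS.
      by rewrite kout // Akout // eq_sym (negPf jp).
    case: (j =P p) => [->|/eqP jp] /=; rewrite ?andbT.
      move=> iS; have {}iS : i \notin S by rewrite iS.
      by rewrite kout // [p == k]eq_sym (negPf kp) Akout // (negPf ip).
    move=> ijS; rewrite -Aout ?ijS //.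
    by case: (i =P k) => [->|_]; case: (j =P k) => [->|_]; rewrite ?An.
  - rewrite !inE; case: eqP => [-> _|/eqP ip iS].
      by rewrite mxE [p == k]eq_sym (negPf kp) ?eqxx.
    by rewrite A'out ?An.
  rewrite !inE mxE; case: (i =P p) => [->|/eqP ip] /=.
    rewrite [p == k]eq_sym (negPf kp) ?eqxx; case: (j =P p) => [-> _ _|/eqP jp _ jS].
      by rewrite [p == k]eq_sym (negPf kp).
    by case: eqP => _; [lia | apply: Am].
  move=> iS; case: (j =P p) => [-> _|/eqP jp jS].
    by rewrite [p == k]eq_sym (negPf kp); case: eqP => _; [lia | apply: Am].
  by case: (i =P k) => _; case: (j =P k) => _ //; apply: Am.
have A'M : extends M A'.
  move=> i j i' j' ii jj.
  have iS : i' \in S by apply: rS; rewrite (ii : nat_of_ord i' = i).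
  have jS : j' \in S by apply: rS; rewrite (jj : nat_of_ord j' = j).
  by rewrite A'out; first exact: AM; [apply: contraNneq pS => <- ..].
have rS' (i : 'I_m) : (i < r)%N -> i \in p |: S by move=> /rS iS; rewrite inE iS orbT.
have := IH (p |: S) A' p _ A'S A'M rS' (setU11 p S).
rewrite A'A detA' cS mulrSr => IHs.
rewrite cS in Ss; have {IHs} := IHs Ss.
move: (\det A) (\det (mask _ _ _)) (\det E) dA => a b e ba h.
have {h} : a < a + (a - b) -> a + (a - b) + (a + (a - b) - a) *+ #|~: (p |: S)| <= e by [].
have -> : a + (a - b) - a = a - b by lia.
by move=> h; rewrite [X in a + X]addrC addrA h // ltrDl subr_gt0.
Qed.

Hypothesis ES : partial_design R n setT E.
Hypothesis EM : extends M E.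

Let rset : {set 'I_m} := [set i : 'I_m | (i < r)%N].

Lemma partial_design_mask S : partial_design R n S (mask N S E).
Proof.
case: ES => Es Ep _ En Em; split=> [|||i iS|i j iS jS].
- apply/matrixP=> i j; rewrite !mxE andbC eq_sym; case: ifP => // _.
  by rewrite -[in LHS]Es mxE.
- exact: posdef_mask.
- by rewrite -/N mask_mask setIid.
- by rewrite mxE iS En ?inE.
- by rewrite mxE iS jS; apply: Em; rewrite inE.
Qed.

Lemma extends_mask (S : {set 'I_m}) :
  (forall i : 'I_m, (i < r)%N -> i \in S) -> extends M (mask N S E).
Proof.
move=> rS i j i' j' ii jj.
have iS : i' \in S by apply: rS; rewrite (ii : nat_of_ord i' = i).
have jS : j' \in S by apply: rS; rewrite (jj : nat_of_ord j' = j).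
by rewrite mxE iS jS; apply: EM.
Qed.

Lemma det_mask_duplication (S : {set 'I_m}) k :
  (forall i : 'I_m, (i < r)%N -> i \in S) -> k \in S ->
  \det (mask N (S :\ k) E) < \det (mask N S E) ->
  \det (mask N S E) + (\det (mask N S E) - \det (mask N (S :\ k) E)) *+ #|~: S| <= \det E.
Proof.
move=> rS kS; have -> : mask N (S :\ k) E = mask N (~: [set k]) (mask N S E).
  by rewrite mask_mask setIC -setDE.
exact: det_duplication (partial_design_mask S) (extends_mask rS) rS kS.
Qed.

(** Strong induction on [#|S|]. At [rset] the index [k0] provides the strict drop that inequality
    (1) needs. For larger [S], some [k] outside [rset] can be removed; if the claim failed for [S],
    the induction hypothesis would make this removal a strict drop. *)
Lemma det_mask_lt_det (S : {set 'I_m}) (k0 : 'I_m) : val k0 = r.-1 -> (0 < r)%N ->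
  \det (mask N (rset :\ k0) E) < \det (mask N rset E) ->
  rset \subset S -> S != setT -> \det (mask N S E) < \det E.
Proof.
move=> k0r r0 hr; have [s] := ubnP #|S|; elim: s => // s IH in S *.
rewrite ltnS => Ss rS ST.
have rS' (i : 'I_m) : (i < r)%N -> i \in S.
  by move=> ir; apply: (subsetP rS); rewrite inE.
(* At least one index is missing, so the left side of (1) strictly exceeds the minor on [S]. *)
have [c cS] : exists c, #|~: S| = c.+1.
  exists (#|~: S|.-1); rewrite prednK // card_gt0 -setCT.
  by apply: contraNneq ST => /setC_inj ->.
have lt_k k : k \in S -> \det (mask N (S :\ k) E) < \det (mask N S E) ->
    \det (mask N S E) < \det E.
  move=> kS lk; have := det_mask_duplication rS' kS lk; rewrite cS mulrS.
  apply: lt_le_trans; rewrite addrA ltr_wpDr ?mulrn_wge0 ?subr_ge0 ?ltW //.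
  by rewrite ltrDl subr_gt0.
have [rSe|] := eqVneq rset S.
  rewrite -rSe in lt_k *; apply: (lt_k k0) => //.
  by rewrite inE (k0r : nat_of_ord k0 = _) ltn_predL.
move=> rnS; have [k kS kr] : exists2 k, k \in S & k \notin rset.
  by apply/subsetPn; apply: contraNN rnS => Sr; rewrite eqEsubset rS.
rewrite ltNge; apply/negP => le_E.
have lk : \det (mask N (S :\ k) E) < \det E.
  apply: IH.
  - by move: Ss; rewrite (cardsD1 k) kS.
  - by rewrite subsetD1 rS.
  - by apply: contraNneq ST => ST; apply/eqP/setP=> i; move/setP/(_ k): ST; rewrite !inE eqxx.
by have := lt_k k kS (lt_le_trans lk le_E); rewrite ltNge le_E.
Qed.

Let NR : (n%:Z%:~R : R) = N%:~R + 3.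
Proof. by rewrite /N rmorphB /= subrK. Qed.

(** The determinant is affine in the corner entry: lowering it from [n] to 3 subtracts [N] times the
    complementary minor, which is the mask without [k]. The index [q] lies outside the leading
    block, so that [D] is a bordering at [k] and [q] with zero column at [q]. *)
Lemma det_mask_lead_lt (k q : 'I_m) : val k = r.-1 -> (0 < r)%N -> (r <= q)%N ->
  0 < \det (tildemx M) ->
  \det (mask N (rset :\ k) E) < \det (mask N rset E).
Proof.
move=> kr r0 rq dM.
have kq : k != q by apply: contraTneq rq => <-; rewrite -ltnNge (kr : nat_of_ord k = _) ltn_predL.
have kS : k \in rset by rewrite inE (kr : nat_of_ord k = _) ltn_predL.
have qS : q \notin rset by rewrite inE -leqNgt.
have [Ds Dp DS Dn _] := partial_design_mask rset.
have DM : extends M (mask N rset E) by apply: extends_mask => // i; rewrite inE.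
rewrite -/N in Ds Dp DS Dn; have lt0 : mask N (rset :\ k) E = mask N (~: [set k]) (mask N rset E).
  by rewrite mask_mask setIC -setDE.
rewrite lt0; move: (mask N rset E) Ds Dp DS Dn DM {lt0} => D Ds Dp DS Dn DM.
have Dout i j : ~~ ((i \in rset) && (j \in rset)) -> D i j = N *+ (i == j).
  by move=> h; rewrite -[in LHS]DS mxE (negPf h).
have Dqj j : D q j = N *+ (q == j) by apply: Dout; rewrite (negPf qS).
have Djq j : D j q = N *+ (j == q) by apply: Dout; rewrite (negPf qS) andbF.
have Dji i j : D j i = D i j by rewrite -[in LHS]Ds mxE.
have D0E : mask N (~: [set k; q]) D = mask N (~: [set k]) D.
  apply/matrixP=> i j; rewrite !mxE !inE.
  case: (i =P q) => [->|_]; first by rewrite !Dqj !if_same.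
  case: (j =P q) => [->|_]; first by rewrite !Djq !if_same.
  by rewrite !orbF.
have bE u i j : bord k q D (D k) (fun=> 0) u 0 N i j =
    if (i == k) && (j == k) then u else D i j.
  rewrite !mxE.
  case: (i =P k) => [->|/eqP ik]; case: (j =P k) => [->|/eqP jk] //=.
  - by case: (j =P q) => [->|//]; rewrite Djq (negPf kq).
  - by case: (i =P q) => [->|//]; rewrite Dqj eq_sym (negPf kq).
  case: (i =P q) => [->|/eqP iq]; first by rewrite Dqj [q == j]eq_sym; case: eqP.
  by case: (j =P q) => [->|//]; rewrite Djq (negPf iq).
have DE : D = bord k q D (D k) (fun=> 0) n%:Z 0 N.
  apply/matrixP=> i j; rewrite bE; case: ifP => // /andP[/eqP -> /eqP ->].
  by rewrite Dn.
have [g [gdet g0 gge gcs]] := det_bord_int N_gt0 kq Ds (posdef_mask _ N_gt0 Dp).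
pose B := bord k q D (D k) (fun=> 0) 3 0 N.
have dB : 0 < \det B.
  (* [B] is [tildemx M] on the leading block and [N] times the identity elsewhere. *)
  rewrite (@det_extends r m N (tildemx M)).
  - by rewrite mulr_gt0 ?exprn_gt0.
  - by rewrite ltnW // (leq_ltn_trans rq).
  - move=> i j i' j' ii jj; rewrite bE mxE -(DM i j i' j' ii jj).
    by rewrite -!val_eqE kr ii jj.
  move=> i j ij; rewrite bE -Dout ?inE //; case: andP => // -[/eqP ik /eqP jk].
  by move: ij; rewrite ik jk; move: kS; rewrite inE => ->.
have D0p : 0 < \det (mask N (~: [set k]) D).
  exact/(@posdef_det_gt0 R)/posdef_mask.
have NR0 : 0 < N%:~R ^+ 2 :> R by rewrite exprn_gt0 // ltr0z.
have eB : \det B = \det D - \det (mask N (~: [set k]) D).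
  apply: (@intr_inj R); rewrite rmorphB /=; apply: (mulIf (lt0r_neq0 NR0)).
  have := gdet (D k) (fun=> 0) n%:Z 0 N; rewrite -DE D0E !g0 NR.
  have := gdet (D k) (fun=> 0) 3 0 N; rewrite -/B D0E !g0 => ->; lra.
by rewrite -subr_gt0 -eB.
Qed.

(** * Optimising one off-diagonal entry *)

(** One triple [a], [b], [c] of Gram values describes [E] with any entry [v] at the pair, and also
    both minors with one index deleted: these are borderings by a zero column with corner [N]. *)
Lemma pair_schur (p q : 'I_m) : p != q ->
  exists a b c : R, let d : R := (\det (mask N (~: [set p; q]) E))%:~R in
  let N' : R := N%:~R in
  [/\ forall v, (\det (bord p q E (E p) (E q) n%:Z v n%:Z))%:~R * N' ^+ 2 =
        d * ((N' + 3 - a) * (N' + 3 - b) - (v%:~R - c) ^+ 2),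
      (\det (mask N (~: [set q]) E))%:~R * N' ^+ 2 = d * ((N' + 3 - a) * N'),
      (\det (mask N (~: [set p]) E))%:~R * N' ^+ 2 = d * (N' * (N' + 3 - b)),
      0 <= a & c ^+ 2 <= a * b].
Proof.
move=> pq; have [Es Ep _ En _] := ES.
have qp : (q == p) = false by rewrite eq_sym (negPf pq).
have [g [gdet g0 gge gcs]] := det_bord_int N_gt0 pq Es (posdef_mask _ N_gt0 Ep).
(* Vanishing in the first argument follows from vanishing in the second by Cauchy-Schwarz. *)
have g0' x : g (fun=> 0) x = 0.
  have := gcs (fun=> 0) x; rewrite g0 mul0r => h.
  by apply/eqP; rewrite -sqrf_eq0 eq_le h sqr_ge0.
exists (g (E p) (E p)), (g (E q) (E q)), (g (E p) (E q)) => /=.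
have Eji i j : E j i = E i j by rewrite -[in LHS]Es mxE.
split; rewrite ?gge ?gcs //.
- by move=> v; rewrite gdet NR.
- have := gdet (E p) (fun=> 0) n%:Z 0 N; rewrite !g0 NR !subr0 expr0n subr0 => <-.
  congr ((\det _)%:~R * _); apply/matrixP=> i j; rewrite !mxE !inE.
  case: (i =P q) => [->|/eqP iq]; case: (j =P q) => [->|/eqP jq];
    rewrite /= ?qp ?eqxx ?(negPf pq) ?mulr1n //.
  + by rewrite [q == j]eq_sym (negPf jq); case: ifP.
  + by rewrite (negPf iq); case: ifP.
  by case: (i =P p) => [->|_]; case: (j =P p) => [->|_]; rewrite ?En ?inE.
have := gdet (fun=> 0) (E q) N 0 n%:Z; rewrite !g0' NR !subr0 expr0n subr0 => <-.
congr ((\det _)%:~R * _); apply/matrixP=> i j; rewrite !mxE !inE.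
case: (i =P p) => [->|/eqP ip]; case: (j =P p) => [->|/eqP jp];
  rewrite /= ?qp ?eqxx ?(negPf pq) ?mulr1n //.
+ by rewrite [p == j]eq_sym (negPf jp); case: ifP.
+ by rewrite (negPf ip); case: ifP.
by case: (i =P q) => [->|_]; case: (j =P q) => [->|_]; rewrite ?En ?inE.
Qed.

Lemma bord_self (p q : 'I_m) : bord p q E (E p) (E q) n%:Z (E p q) n%:Z = E.
Proof.
have [Es _ _ En _] := ES.
have Eji i j : E j i = E i j by rewrite -[in LHS]Es mxE.
apply/matrixP=> i j; rewrite !mxE.
case: (i =P p) => [->|_].
  by case: (j =P p) => [->|_]; [rewrite En ?inE | case: (j =P q) => [->|_]].
case: (i =P q) => [->|_].
  case: (j =P p) => [->|_]; first by rewrite Eji.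
  by case: (j =P q) => [->|//]; rewrite En ?inE.
case: (j =P p) => [->|_]; first by rewrite Eji.
by case: (j =P q) => [->|//]; rewrite Eji.
Qed.

(** The minor without [p] does not see the changed entry, so a positive determinant suffices for
    positive definiteness; the leading block is untouched as both indices are at least [r]. *)
Lemma frakE_bord (p q : 'I_m) v : p != q -> (r <= p)%N -> (r <= q)%N ->
  (v = n%:Z %[mod 4])%Z -> 0 < \det (bord p q E (E p) (E q) n%:Z v n%:Z) ->
  frakE R n M (bord p q E (E p) (E q) n%:Z v n%:Z).
Proof.
move=> pq rp rq vn d0; have [Es Ep _ En Em] := ES.
set E' := bord _ _ _ _ _ _ _ _ in d0 *.
have E'E i j : E' i j = if (i == p) && (j == q) || (i == q) && (j == p) then v else E i j.
  have Eji k l : E l k = E k l by rewrite -[in LHS]Es mxE.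
  rewrite mxE; case: (i =P p) => [->|_].
    rewrite (negPf pq) orbF; case: (j =P p) => [->|_]; last by case: (j =P q) => [->|].
    by rewrite (negPf pq) En ?inE.
  case: (i =P q) => [->|_] /=.
    case: (j =P p) => //= _.
    by case: (j =P q) => [->|_] //; rewrite En ?inE.
  case: (j =P p) => [->|_]; first by rewrite Eji.
  by case: (j =P q) => [->|_] //; rewrite Eji.
have E's : E'^T = E' by apply: bord_sym.
split; first split=> //.
- apply: (posdef_of_det_gt0 (p := p) N_gt0) => //.
  have -> : mask N (~: [set p]) E' = mask N (~: [set p]) E; last exact: posdef_mask.
  apply/matrixP=> i j; rewrite ![mask _ _ _ _ _]mxE !inE E'E.
  by case: (i =P p) => //= _; case: (j =P p) => //= _; rewrite andbF.
- move=> i; rewrite E'E En ?inE //; case: ifP => // /orP[]/andP[/eqP->];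
  by rewrite ?[q == p]eq_sym (negPf pq).
- by move=> i j; rewrite E'E; case: ifP => // _; apply: Em; rewrite inE.
move=> i j i' j' ii jj; rewrite E'E -(EM ii jj).
have ip (k : 'I_m) (l : 'I_r) s : (r <= s)%N -> val k = val l -> nat_of_ord k != s.
  move=> rs kl; rewrite (kl : nat_of_ord k = l) neq_ltn.
  by rewrite (leq_trans (ltn_ord l)).
have i'p : i' != p by apply: (ip i' i p rp ii).
have i'q : i' != q by apply: (ip i' i q rq ii).
by rewrite (negPf i'p) (negPf i'q).
Qed.

Lemma maximal_offdiag (p q : 'I_m) : p != q -> (r <= p)%N -> (r <= q)%N ->
  (forall S : {set 'I_m}, rset \subset S -> S != setT -> \det (mask N S E) < \det E) ->
  E p q = -1 \/ E p q = 3.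
Proof.
move=> pq rp rq lt_E.
have [Es Ep _ En Em] := ES.
have N0 : 0 < N%:~R :> R by rewrite ltr0z.
have D0 S : 0 < (\det (mask N S E))%:~R :> R.
  by rewrite ltr0z; apply/(@posdef_det_gt0 R)/posdef_mask.
(* If neither single deletion has a minor above that of the double deletion, [schur_le] bounds
   [\det E] by a proper minor, against [lt_E]. *)
wlog lt_q : p q pq rp rq / \det (mask N (~: [set p; q]) E) < \det (mask N (~: [set q]) E).
  move=> W; have [|le_q] := ltP (\det (mask N (~: [set p; q]) E)) (\det (mask N (~: [set q]) E)).
    exact: W.
  have [lt_p|le_p] := ltP (\det (mask N (~: [set p; q]) E)) (\det (mask N (~: [set p]) E)).
    by rewrite -Es mxE; apply: W => //; rewrite 1?eq_sym // setUC.
  have : \det (mask N (~: [set p; q]) E) < \det E.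
    apply: lt_E; last by apply/eqP=> /setP/(_ p); rewrite !inE eqxx.
    apply/subsetP=> i; rewrite !inE => ir.
    by apply/norP; split; [apply: contraTneq ir => -> ..]; rewrite -leqNgt.
  have [a [b [c [/(_ (E p q)) + eq ep _ _]]]] := pair_schur pq; rewrite bord_self => eE.
  rewrite ltNge -(ler_int R) => /negP[].
  by apply: schur_le eE eq ep; rewrite ?ler_int.
have [a [b [c [eE eq _ a0 cab]]]] := pair_schur pq.
(* Inequality (1) with exactly one missing index, [q], filled by a copy of row [p]. *)
have Eqp : \det (mask N (~: [set q]) E) +
    (\det (mask N (~: [set q]) E) - \det (mask N (~: [set p; q]) E)) <= \det E.
  have := @det_mask_duplication (~: [set q]) p.
  have -> : ~: [set q] :\ p = ~: [set p; q] by rewrite setDE -setCU setUC.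
  rewrite setCK cards1; apply=> //; last by rewrite !inE.
  by move=> i ir; rewrite !inE; apply: contraTneq ir => ->; rewrite -leqNgt.
have c9 : c ^+ 2 < 9.
  have := eE (E p q); rewrite bord_self => eEpq.
  apply: (schur_corr_lt (D0 (~: [set p; q])) N0 a0 cab eEpq eq).
    by rewrite ltr_int.
  by rewrite -rmorphB -rmorphD ler_int.
(* The determinant decreases strictly in (v - c)^2, so maximality puts [E p q] at least as close to
   [c] as any admissible [v]. *)
have better v : (v = n%:Z %[mod 4])%Z -> ((E p q)%:~R - c) ^+ 2 <= (v%:~R - c) ^+ 2.
  move=> vn; rewrite leNgt; apply/negP => lt_v.
  have : \det E < \det (bord p q E (E p) (E q) n%:Z v n%:Z).
    rewrite -(ltr_int R) -(ltr_pM2r (exprn_gt0 2 N0)) eE -{1}(bord_self p q) eE.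
    by rewrite ltr_pM2l // ltrD2l ltrN2.
  move=> lt_d; have : 0 < \det E by apply: (@posdef_det_gt0 R).
  move=> /lt_trans /(_ lt_d) /(frakE_bord pq rp rq vn) /E_max.
  by rewrite leNgt lt_d.
have [b1 b3] := (better (-1) (ltac:(lia)), better 3 (ltac:(lia))).
have [c_lo c_hi] : -3 < c /\ c < 3 by split; nra.
have := Em p q; rewrite !inE => /(_ isT isT) Epq.
(* The entry is 3 modulo 4, so besides -1 and 3 only these two ranges remain. *)
have [E7|[E5|//]] : 7 <= E p q \/ (E p q <= -5 \/ (E p q = -1 \/ E p q = 3)) by lia.
  have {}E7 : 7 <= (E p q)%:~R :> R by rewrite (ler_int R 7).
  move: (E p q)%:~R E7 b3 => x x7 b3; exfalso.
  (* The product is (x - c)^2 - (3 - c)^2, which [b3] bounds by 0; the next case is the same with -1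
     in place of 3. *)
  have := @mulr_gt0 R (x - 3) (x + 3 - 2 * c) (ltac:(lra)) (ltac:(lra)); lra.
have {}E5 : (E p q)%:~R <= -5 :> R by rewrite (ler_int R _ (-5)).
move: (E p q)%:~R E5 b1 => x x5 b1; exfalso.
have := @mulr_gt0 R (- 1 - x) (1 + 2 * c - x) (ltac:(lra)) (ltac:(lra)); lra.
Qed.

End Maximal.

Theorem theorem8 (R : realType) (n r m : nat) (M : 'M[int]_r) (Estar : 'M[int]_m) :
  (n %% 4 = 3)%N -> (3 < n)%N ->
  (1 <= r)%N -> (r <= m)%N ->
  frakC R n M ->
  0 < \det (tildemx M) ->
  frakE R n M Estar ->
  (forall E : 'M[int]_m, frakE R n M E -> \det E <= \det Estar) ->
  forall i j : 'I_m, (r <= i)%N -> (r <= j)%N -> i != j ->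
    Estar i j = -1 \/ Estar i j = 3.
Proof.
move=> n_mod n_gt3 r0 rm _ dM [[Es Ep En Em] EM] E_max i j ri rj ij.
have ES : partial_design R n setT Estar.
  by split; rewrite ?mask_setT.
have kr : (r.-1 < m)%N by rewrite prednK.
(* The last index of the leading block, where [tildemx M] differs from [M]; [i] itself then serves
   as the index outside that block. *)
pose k := Ordinal kr.
apply: (maximal_offdiag n_mod n_gt3 E_max ES EM ij ri rj) => S rS ST.
apply: (det_mask_lt_det n_mod n_gt3 E_max ES EM (k0 := k)) => //.
exact: (det_mask_lead_lt n_gt3 ES EM (k := k) (q := i)).
Qed.
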